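(* For $\mu\in\mathbb{R}$ let $\mathbb{P}_\mu$ be the distribution under which $X_1,X_2,\dots$ are i.i.d. $\mathcal{N}(\mu,1)$. Let $f(1)=f(2)=1$ and $f(n)=n^{-1}\log\log n$ for $n\ge3$. (i) Upper bound. There exists a constant $C>0$ such that $$\sup_{\mu\in\mathbb{R}}\mathbb{E}_{X^\infty\sim\mathbb{P}_\mu}\left[\sup_{n\in\mathbb{N}}\frac{(\mu-\hat\mu^{\mathrm{MLE}}_n)^2}{f(n)}\right]\le C,$$ where $\hat\mu^{\mathrm{MLE}}_n=\frac1n\sum_{i=1}^nX_i$ is the maximum likelihood estimator. (ii) Lower bound. Let $\mathcal{T}$ be the collection of all a.s. finite stopping times with respect to the filtration $(\sigma(X_1,\dots,X_n))_{n\in\mathbb{N}}$. There is a constant $C>0$ such that for any estimator $\hat\mu=(\hat\mu_n)_{n\in\mathbb{N}}$, $\hat\mu_n=\hat\mu(X^n)$, $$\sup_{\mu\in\mathbb{R}}\sup_{\tau\in\mathcal{T}}\mathbb{E}_{X^\infty\sim\mathbb{P}_\mu}\left[\frac{(\mu-\hat\mu_\tau)^2}{f(\tau)}\right]\ge C,$$ and $$\sup_{\mu\in\mathbb{R}}\sup_{\tau\in\mathcal{T}}\mathbb{E}_{X^\infty\sim\mathbb{P}_\mu}\left[\frac{(\mu-\hat\mu_\tau)^2}{g(\tau)}\right]=\infty$$ for all non-increasing $g:\mathbb{N}\to\mathbb{R}^+$ such that $f(n)/g(n)\to\infty$ as $n\to\infty$.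
   Context: $X^n=(X_1,\dots,X_n)$ and $X^\infty=(X_1,X_2,\dots)$. An estimator is a collection $(\hat\mu_n)_{n\in\mathbb{N}}$ where each $\hat\mu_n=\hat\mu(X^n)$ is a (measurable) function $\mathbb{R}^n\to\mathbb{R}$ of the first $n$ observations. Stopping times take values in $\mathbb{N}=\{1,2,\dots\}$. *)

(* Defs.v *)
From HB Require Import structures.
From mathcomp Require Import all_boot all_order all_algebra.
From mathcomp Require Import all_classical all_reals all_analysis.

Set Implicit Arguments.
Unset Strict Implicit.
Unset Printing Implicit Defensive.

Import Order.TTheory GRing.Theory Num.Theory.
Import numFieldNormedType.Exports.

Local Open Scope classical_set_scope.
Local Open Scope ring_scope.

(* Indices are shifted: the coordinate [x i] of a sequence [x] is the
   observation X_(i+1), so that [fun i : 'I_n => x i] is X^n = (X_1, ..., X_n).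
   Sample sizes are not shifted: they are the n : nat with 0 < n. *)

Definition seqspace (R : realType) : Type := nat -> R.

Definition seqcoord {R : realType} (i : nat) (x : seqspace R) : R := x i.

Definition obs {R : realType} (n : nat) (x : seqspace R) : n.-tuple R :=
  [tuple seqcoord i x | i < n].

Definition coord_cylinders (R : realType) : set (set (seqspace R)) :=
  \bigcup_i preimage_set_system [set: seqspace R] (seqcoord i) measurable.
Arguments coord_cylinders R : clear implicits.

HB.instance Definition _ (R : realType) :=
  Measurable.copy (seqspace R) (g_sigma_algebraType (coord_cylinders R)).

Section iid.
Context {R : realType}.
Implicit Type P : probability (seqspace R) R.
Local Open Scope ereal_scope.

Definition independent_coords P : Prop :=
  forall (J : seq nat) (A : nat -> set R), uniq J ->
    (forall i, i \in J -> measurable (A i)) ->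
    P (\bigcap_(i in [set` J]) (seqcoord i @^-1` A i)) =
    \prod_(i <- J) P (seqcoord i @^-1` A i).

Definition iid_normal1 (mu : R) P : Prop :=
  independent_coords P /\
  forall (i : nat) (A : set R), measurable A ->
    P (seqcoord i @^-1` A) = normal_prob mu 1 A.

End iid.

Section estimation.
Context {R : realType}.

Definition rate (n : nat) : R :=
  if (n <= 2)%N then 1 else n%:R^-1 * ln (ln n%:R).

Definition is_estimator (muhat : forall n, n.-tuple R -> R) : Prop :=
  forall n, measurable_fun [set: n.-tuple R] (muhat n).

Definition mle (n : nat) (s : n.-tuple R) : R :=
  n%:R^-1 * \sum_(i < n) tnth s i.

Definition natural_filtration (n : nat) : set (set (seqspace R)) :=
  g_sigma_preimage (fun (i : 'I_n) (x : seqspace R) => seqcoord i x).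

(* [None] stands for the value +oo. *)
Definition is_stopping_time (tau : seqspace R -> option nat) : Prop :=
  (forall x, tau x <> Some 0%N) /\
  forall n, (0 < n)%N ->
    natural_filtration n [set x | exists2 m, tau x = Some m & (m <= n)%N].

(* The collection does not depend on the mean, so "almost surely" is understood
   under every law of the family. *)
Definition finite_stopping_times (P : R -> probability (seqspace R) R) :
    set (seqspace R -> option nat) :=
  [set tau | is_stopping_time tau /\
             forall mu, {ae P mu, forall x, tau x <> None}].

Definition scaled_loss (muhat : forall n, n.-tuple R -> R) (r : nat -> R)
    (mu : R) (n : nat) (x : seqspace R) : R :=
  (mu - muhat n (obs n x)) ^+ 2 / r n.

Local Open Scope ereal_scope.

Definition sup_risk (P : R -> probability (seqspace R) R)
    (muhat : forall n, n.-tuple R -> R) (r : nat -> R) (mu : R) : \bar R :=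
  \int[P mu]_x
    ereal_sup [set (scaled_loss muhat r mu n x)%:E | n in [set n | (0 < n)%N]].

(* The value of the integrand at tau = +oo is immaterial, this event being null
   for the stopping times under consideration. *)
Definition stopped_risk (P : R -> probability (seqspace R) R)
    (muhat : forall n, n.-tuple R -> R) (r : nat -> R) (mu : R)
    (tau : seqspace R -> option nat) : \bar R :=
  \int[P mu]_x
    (if tau x is Some n then (scaled_loss muhat r mu n x)%:E else 0).

Definition worst_stopped_risk (P : R -> probability (seqspace R) R)
    (muhat : forall n, n.-tuple R -> R) (r : nat -> R) : \bar R :=
  ereal_sup [set ereal_sup [set stopped_risk P muhat r mu tau
                             | tau in finite_stopping_times P]
              | mu in [set: R]].

End estimation.

(* Main.v *)
(* Write S_n for the sum of X_i - mu, i <= n. Upper bound: for k >= 0 put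
   t_k = sqrt(log(k+2) / 2^k) and weight w_k = (k+2)^-2. Then
   M_n = 1 + sum_k w_k (exp(t_k S_n - n t_k^2/2) + exp(-t_k S_n - n t_k^2/2))
   is a positive martingale, and the term with 2^k <= n < 2^(k+1) alone shows
   (S_n/n)^2 / f(n) <= C sqrt(M_n). With M*_n the running maximum,
   sqrt(M*_n) + M_n / sqrt(M*_n) is a supermartingale, whence
   E sup_n sqrt(M_n) <= 2 sqrt(M_0).

   Lower bound: let n_k = 64^k and d_k = 2 sqrt(f(n_k)), and suppose that for
   every mu, with probability at least 3/4, the estimator is d_k/4-close to mu
   at all times n_k of a long window. Let mu run over the 2^K sums of the d_k
   with coefficients 0 or 1. As the d_k decrease geometrically, being close to
   mu at time n_k determines the k-th coefficient given the previous ones. Two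
   values of mu that differ only in this coefficient are at distance d_k, so the
   affinity of their laws up to time n_k is exp(-n_k d_k^2/8), of square
   1/(k log 64), and the coefficient is missed for the first time at n_k with
   probability at least of order 1/k on average over mu. These events are
   disjoint while the harmonic series diverges: a contradiction. Hence for some
   mu, stopping at the first bad n_k gives loss at least f(n_k)/4 with
   probability at least 1/4.

   Conditioning is replaced by resampling: the law of an i.i.d. sequence is
   invariant under redrawing one coordinate independently. *)
Require Import Defs.
From HB Require Import structures.
From mathcomp Require Import all_boot all_order all_algebra.
From mathcomp Require Import all_classical all_reals all_analysis.
From mathcomp Require Import measurable_realfun ring lra.

Set Implicit Arguments.
Unset Strict Implicit.
Unset Printing Implicit Defensive.

Import Order.TTheory GRing.Theory Num.Theory.
Import numFieldNormedType.Exports.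

Local Open Scope classical_set_scope.
Local Open Scope ring_scope.

(** * Unit-variance normal laws: densities and exponential tilts *)

Section normal.
Context {R : realType}.
Local Open Scope ereal_scope.

(** The Radon-Nikodym derivative is determined only almost everywhere. It has the same integral as
    [normal_pdf m 1] over every measurable set, hence agrees with it almost everywhere and can be
    replaced by it. *)
Lemma ge0_integral_normal_prob (m : R) (f : R -> \bar R) :
  measurable_fun [set: R] f -> (forall x, 0 <= f x) ->
  \int[normal_prob m 1%R]_x f x =
  \int[lebesgue_measure]_x (f x * (normal_pdf m 1%R x)%:E).
Proof.
move=> mf f0; have dom := @normal_prob_dominates R m 1%R.
rewrite -(Radon_Nikodym_SigmaFinite.change_of_variables dom)//.
apply: ge0_ae_eq_integral => //=.
- apply: emeasurable_funM => //.
  exact: measurable_int (Radon_Nikodym_SigmaFinite.f_integrable _).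
- apply: emeasurable_funM => //; apply/measurable_EFinP.
  exact: measurable_normal_pdf.
- by move=> x _; rewrite mule_ge0// Radon_Nikodym_SigmaFinite.f_ge0.
- by move=> x _; rewrite mule_ge0// lee_fin normal_pdf_ge0.
apply: ae_eqe_mul2l; apply: integral_ae_eq => //.
- exact: Radon_Nikodym_SigmaFinite.f_integrable.
- by apply/measurable_EFinP; exact: measurable_normal_pdf.
- by move=> E _ mE; rewrite -Radon_Nikodym_SigmaFinite.f_integral.
Qed.

Lemma normal_pdf_shift (m m' z : R) :
  (normal_pdf m' 1%R z =
   normal_pdf m 1%R z * expR ((m' - m) * (z - m) - (m' - m) ^+ 2 / 2))%R.
Proof.
rewrite !normal_pdfE ?oner_neq0// /normal_fun -mulrA -expRD; congr (_ * expR _)%R.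
by field.
Qed.

Lemma ge0_integral_normal_shift (m m' : R) (f : R -> \bar R) :
  measurable_fun [set: R] f -> (forall x, 0 <= f x) ->
  \int[normal_prob m' 1%R]_z f z =
  \int[normal_prob m 1%R]_z
    (f z * (expR ((m' - m) * (z - m) - (m' - m) ^+ 2 / 2))%:E).
Proof.
move=> mf f0; have mE : measurable_fun [set: R]
  (fun z => (expR ((m' - m) * (z - m) - (m' - m) ^+ 2 / 2))%:E).
  apply/measurable_EFinP; apply: measurableT_comp => //.
  apply: measurable_funB => //; apply: measurable_funM => //.
  exact: measurable_funB.
rewrite !ge0_integral_normal_prob//; first last.
- by move=> z; rewrite mule_ge0// lee_fin expR_ge0.
- exact: emeasurable_funM.
by apply: eq_integral => z _; rewrite -muleA -EFinM (normal_pdf_shift m) mulrC.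
Qed.

(** The integrand is the density of the law of mean [m + t] relative to that of mean [m], so its
    integral is a total mass. This is the one-step martingale property behind the upper bound. *)
Lemma integral_normal_expR (m t : R) :
  \int[normal_prob m 1%R]_z (expR (t * (z - m) - t ^+ 2 / 2))%:E = 1.
Proof.
transitivity (\int[normal_prob (m + t)%R 1%R]_z 1).
  rewrite (@ge0_integral_normal_shift m (m + t))//.
  by apply: eq_integral => z _; rewrite mul1e addrAC subrr add0r.
by rewrite integral_cst// mul1e; exact: probability_setT.
Qed.

End normal.

(** * Invariance of an i.i.d. law under redrawing one coordinate *)

Section resampling.
Context {R : realType}.
Implicit Types (P : probability (seqspace R) R) (A : nat -> set R).

Lemma measurable_seqcoord i : measurable_fun [set: seqspace R] (seqcoord i).
Proof.
move=> _ Y mY; rewrite setTI; apply: sub_sigma_algebra.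
by exists i => //; exists Y => //; rewrite setTI.
Qed.

Lemma measurable_fun_seqspace d (T : measurableType d) (f : T -> seqspace R) :
  (forall i, measurable_fun [set: T] (fun t => seqcoord i (f t))) ->
  measurable_fun [set: T] f.
Proof.
move=> mf; apply: (@measurability _ _ _ (seqspace R) _ _ (coord_cylinders R)) => //.
move=> _ [B [i _ [Y mY <-]] <-]; rewrite setTI setTI.
by have := mf i measurableT _ mY; rewrite setTI.
Qed.

Definition resample (n : nat) (y : seqspace R * R) : seqspace R :=
  fun i => if i == n then y.2 else y.1 i.

Lemma measurable_resample n :
  measurable_fun [set: seqspace R * R] (resample n).
Proof.
apply: measurable_fun_seqspace => i; rewrite /seqcoord /resample.
case: (i == n); first exact: measurable_snd.
exact: (measurableT_comp (measurable_seqcoord i) measurable_fst).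
Qed.

Definition cylinder A : set (seqspace R) := \bigcap_i (seqcoord i @^-1` A i).

(** A generating pi-system. The sides form a total family, equal to [setT] from some index on, so
    that intersections are taken side by side. *)
Definition finite_cylinders : set (set (seqspace R)) :=
  [set C | exists N, exists A, [/\ forall i, measurable (A i),
    forall i, (N <= i)%N -> A i = setT & C = cylinder A]].

Lemma measurable_cylinder A : (forall i, measurable (A i)) ->
  measurable (cylinder A).
Proof.
move=> mA; apply: bigcapT_measurable => i.
by rewrite -[X in measurable X]setTI; exact: measurable_seqcoord.
Qed.

Lemma finite_cylinders_generate :
  @measurable _ (seqspace R) = <<s finite_cylinders >>.
Proof.
apply/seteqP; split.
- apply: sub_sigma_algebra2 => _ [i _ [Y mY <-]].
  exists i.+1, (fun j => if j == i then Y else setT); split.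
  + by move=> j; case: ifP.
  + by move=> j ij; rewrite gtn_eqF.
  + rewrite setTI; apply/seteqP; split => x /=.
      by move=> xY j _ /=; case: eqP => // ->.
    by move=> /(_ i I) /=; rewrite eqxx.
- apply: smallest_sub; first exact: sigma_algebra_measurable.
  by move=> _ [N [A [mA _ ->]]]; exact: measurable_cylinder.
Qed.

Lemma setI_closed_finite_cylinders : setI_closed finite_cylinders.
Proof.
move=> _ _ [N [A [mA AT ->]]] [N' [A' [mA' AT' ->]]].
exists (maxn N N'), (fun i => A i `&` A' i); split.
- by move=> i; exact: measurableI.
- by move=> i; rewrite geq_max => /andP[Ni N'i]; rewrite AT// AT'// setTI.
- by rewrite /cylinder -bigcapI.
Qed.

Local Open Scope ereal_scope.

Lemma iid_cylinder mu P N A : iid_normal1 mu P ->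
  (forall i, measurable (A i)) -> (forall i, (N <= i)%N -> A i = setT) ->
  P (cylinder A) = \prod_(i <- iota 0 N) normal_prob mu 1%R (A i).
Proof.
move=> [indP normP] mA AT.
have -> : cylinder A = \bigcap_(i in [set` iota 0 N]) (seqcoord i @^-1` A i).
  apply/seteqP; split=> x xA i; first by move=> _; exact: xA.
  move=> _; have [iN|Ni] := ltnP i N.
    by apply: xA; rewrite /= mem_iota.
  by rewrite /= AT.
by rewrite indP ?iota_uniq//; apply: eq_bigr => i _; exact: normP.
Qed.

(** Both sides are measures of mass one, so agreement on finite cylinders is enough; there the fresh
    draw supplies the factor of coordinate [n]. *)
Lemma pushforward_resample mu P n B : iid_normal1 mu P -> measurable B ->
  P B = pushforward (P \x normal_prob mu 1%R) (resample n) B.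
Proof.
move=> iidP; have mphi := @measurable_resample n.
pose mphi_mixin := isMeasurableFun.Build _ _ _ _ _ mphi.
pose phi : {mfun _ >-> _} := HB.pack (resample n) mphi_mixin.
apply: (@measure_unique _ _ _ finite_cylinders (fun=> setT) _ _ _ _
  P (pushforward (P \x normal_prob mu 1%R) phi)).
- exact: finite_cylinders_generate.
- exact: setI_closed_finite_cylinders.
- move=> _; exists 0%N, (fun=> setT); split => //.
  by apply/seteqP; split.
- by apply/seteqP; split => // x _; exists 0%N.
- move=> _ [N [A [mA AT ->]]].
  (* [A'] frees coordinate [n], whose constraint is taken over by the fresh draw. *)
  pose A' i := if i == n then setT else A i.
  have mA' i : measurable (A' i) by rewrite /A'; case: ifP.
  (* The bound [maxn N n.+1] makes [n] one of the listed factors even when [N <= n]. *)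
  have AT' i : (maxn N n.+1 <= i)%N -> A i = setT /\ A' i = setT.
    by rewrite geq_max => /andP[Ni ni]; rewrite /A' AT//; case: ifP.
  have phiA : resample n @^-1` cylinder A = cylinder A' `*` A n.
    apply/seteqP; split => [[x z]|[x z] [/= xA zA]].
      move=> xA; split => [i _|].
        by have := xA i I; rewrite /= /seqcoord /resample /A'; case: ifP.
      by have := xA n I; rewrite /= /seqcoord /resample eqxx.
    move=> i _; have := xA i I; rewrite /= /seqcoord /resample /A'.
    by case: eqP => // ->.
  rewrite -[RHS]/((P \x normal_prob mu 1%R) (resample n @^-1` cylinder A)) phiA.
  rewrite product_measure1E; [|exact: measurable_cylinder|exact: mA].
  apply: (eq_trans (iid_cylinder iidP mA (fun i Ni => (AT' i Ni).1))).
  have PA' := iid_cylinder iidP mA' (fun i Ni => (AT' i Ni).2).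
  apply/esym/(eq_trans (congr1 (fun u => u * normal_prob mu 1%R (A n)) PA')).
  have nN : n \in iota 0 (maxn N n.+1) by rewrite mem_iota /= leq_max ltnSn orbT.
  rewrite (big_rem n)//= [in RHS](big_rem n)//= {1}/A' eqxx.
  rewrite [X in X * _ * _](_ : _ = 1); last exact: probability_setT.
  rewrite mul1e muleC; congr (_ * _).
  apply: eq_big_seq => i; rewrite mem_rem_uniq ?iota_uniq// inE /A'.
  by case: (i == n).
- move=> _ /=; exact: le_lt_trans (probability_le1 _ _) (ltry _).
Qed.

(** Replaces the tower property: the inner integral acts as the conditional expectation given all
    coordinates other than [n]. *)
Lemma ge0_integral_resample mu P n (F : seqspace R -> \bar R) :
  iid_normal1 mu P -> measurable_fun [set: seqspace R] F ->
  (forall x, 0 <= F x) ->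
  \int[P]_x F x =
  \int[P]_x \int[normal_prob mu 1%R]_z F (resample n (x, z)).
Proof.
move=> iidP mF F0.
have mphi := @measurable_resample n.
pose mphi_mixin := isMeasurableFun.Build _ _ _ _ _ mphi.
pose phi : {mfun _ >-> _} := HB.pack (resample n) mphi_mixin.
rewrite (eq_measure_integral (pushforward (P \x normal_prob mu 1%R) phi)); last first.
  by move=> B mB _; exact: pushforward_resample.
rewrite ge0_integral_pushforward//= preimage_setT.
by rewrite fubini_tonelli1//; exact: measurableT_comp.
Qed.

End resampling.

(** * Integrals of constants and a Markov-type lower bound *)

Section probability_integral.
Context d (T : measurableType d) (R : realType) (Q : probability T R).
Local Open Scope ereal_scope.

Lemma probability_integral_cst (c : \bar R) : \int[Q]_x c = c.
Proof.
by rewrite -[RHS]mule1 -(@probability_setT _ _ _ Q); exact: integral_cst.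
Qed.

(** The indicator of [A] scaled by [c] is a simple function below [f], and the integral of [f] is a
    supremum over such functions. The stopped loss can thus be bounded without proving it
    measurable. *)
Lemma ge0_integral_ge_cst (A : set T) (c : R) (f : T -> \bar R) :
  (0 <= c)%R -> measurable A -> (forall x, 0 <= f x) ->
  (forall x, A x -> c%:E <= f x) -> c%:E * Q A <= \int[Q]_x f x.
Proof.
move=> c0 mA f0 cf; rewrite ge0_integralTE//; apply: ereal_sup_ubound.
exists (scale_nnsfun (indic_nnsfun R mA) c0).
  move=> x; rewrite /= mindicE; have [xA|_] := boolP (x \in A).
    by rewrite mulr1; apply: cf; rewrite in_setE in xA.
  by rewrite mulr0.
rewrite sintegralrM; congr (_ * _).
by rewrite -[RHS]sintegral_indic.
Qed.

End probability_integral.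

(** * Likelihood ratios and the two-point comparison *)

Section change_of_measure.
Context {R : realType}.
Variable P : R -> probability (seqspace R) R.
Hypothesis iidP : forall mu, iid_normal1 mu (P mu).

(** Pointwise form of adaptedness. As sets are functions to [Prop], it covers events too. *)
Definition depends_on {T : Type} (n : nat) (F : seqspace R -> T) :=
  forall x y, (forall i, (i < n)%N -> x i = y i) -> F x = F y.

Lemma depends_onW {T : Type} m n (F : seqspace R -> T) :
  (m <= n)%N -> depends_on m F -> depends_on n F.
Proof. by move=> mn dF x y xy; apply: dF => i im; apply/xy/(leq_trans im). Qed.

Definition partial_sum (n : nat) (x : seqspace R) : R :=
  \sum_(i < n) seqcoord i x.

Lemma depends_on_partial_sum n : depends_on n (partial_sum n).
Proof. by move=> x y xy; apply: eq_bigr => i _; exact: xy. Qed.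

Lemma measurable_partial_sum n : measurable_fun [set: seqspace R] (partial_sum n).
Proof. by apply: measurable_sum => i; exact: measurable_seqcoord. Qed.

Lemma resample_lt n (x : seqspace R) z i : (i < n)%N -> resample n (x, z) i = x i.
Proof. by move=> ni; rewrite /resample ltn_eqF. Qed.

Lemma depends_on_resample {T : Type} m n (F : seqspace R -> T) x z :
  (m <= n)%N -> depends_on m F -> F (resample n (x, z)) = F x.
Proof.
by move=> mn dF; apply: dF => i im; rewrite resample_lt// (leq_trans im).
Qed.

Lemma partial_sum_resample n x z :
  partial_sum n.+1 (resample n (x, z)) = partial_sum n x + z.
Proof.
rewrite /partial_sum big_ord_recr/= {2}/seqcoord /resample eqxx; congr (_ + _).
exact: (depends_on_resample _ _ (leqnn n) (@depends_on_partial_sum n)).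
Qed.

Lemma measurable_resample2 n (x : seqspace R) :
  measurable_fun [set: R] (fun z => resample n (x, z)).
Proof. by apply: (measurableT_comp (@measurable_resample R n)). Qed.

(** Likelihood ratio of mean [mu] against mean 0 for the first [n] observations. *)
Definition likelihood (mu : R) (n : nat) (x : seqspace R) : R :=
  expR (mu * partial_sum n x - n%:R * mu ^+ 2 / 2).

Lemma measurable_likelihood mu n :
  measurable_fun [set: seqspace R] (likelihood mu n).
Proof.
apply: measurableT_comp => //; apply: measurable_funB => //.
by apply: measurable_funM => //; exact: measurable_partial_sum.
Qed.

Lemma likelihood_resample mu n x z : likelihood mu n.+1 (resample n (x, z)) =
  likelihood mu n x * expR (mu * z - mu ^+ 2 / 2).
Proof.
rewrite /likelihood partial_sum_resample -expRD -natr1; congr expR.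
by field.
Qed.

Local Open Scope ereal_scope.

Lemma measurable_integral_resample mu n (F : seqspace R -> \bar R) :
  measurable_fun [set: seqspace R] F -> (forall x, 0 <= F x) ->
  measurable_fun [set: seqspace R]
    (fun x => \int[normal_prob mu 1%R]_z F (resample n (x, z))).
Proof.
move=> mF F0.
apply: (@measurable_fun_fubini_tonelli_F _ _ _ _ _ (normal_prob mu 1%R)
  (F \o @resample R n)) => //=.
by apply: measurableT_comp => //; exact: measurable_resample.
Qed.

(** Induction on [n]: redraw the last observation, apply the induction hypothesis to the inner
    integral, which depends on one observation fewer, and shift the mean of the redrawn one. *)
Lemma change_of_measure mu n (F : seqspace R -> \bar R) :
  measurable_fun [set: seqspace R] F -> (forall x, 0 <= F x) ->
  depends_on n F ->
  \int[P mu]_x F x = \int[P 0%R]_x (F x * (likelihood mu n x)%:E).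
Proof.
elim: n F => [|n IH] F mF F0 dF.
  have F_cst x : F x = F point by apply: dF.
  transitivity (F point).
    by rewrite (eq_integral (cst (F point)))// probability_integral_cst.
  rewrite (eq_integral (cst (F point))) => [|x _].
    by rewrite probability_integral_cst.
  by rewrite F_cst /likelihood /partial_sum big_ord0 mulr0 !mul0r subrr expR0 mule1.
have mL : measurable_fun [set: seqspace R]
    (fun x => F x * (likelihood mu n.+1 x)%:E).
  apply: emeasurable_funM => //; apply/measurable_EFinP.
  exact: measurable_likelihood.
rewrite (@ge0_integral_resample _ mu _ n)// IH; first last.
- move=> x y xy; apply: eq_integral => z _; apply: dF => i.
  rewrite ltnS leq_eqVlt /resample; case: eqP => //= _; exact: xy.
- by move=> x; apply: integral_ge0.
- exact: measurable_integral_resample.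
rewrite [RHS](@ge0_integral_resample _ 0%R _ n)//; last first.
  by move=> x; rewrite mule_ge0// lee_fin expR_ge0.
apply: eq_integral => x _.
have mFx : measurable_fun [set: R] (fun z => F (resample n (x, z))).
  by apply: measurableT_comp => //; exact: measurable_resample2.
rewrite (ge0_integral_normal_shift 0%R)// -ge0_integralZr//=; first last.
- by rewrite lee_fin expR_ge0.
- by move=> z _; rewrite mule_ge0// lee_fin expR_ge0.
- apply: emeasurable_funM => //; apply/measurable_EFinP.
  apply: measurableT_comp => //; apply: measurable_funB => //.
  by apply: measurable_funM => //; exact: measurable_funB.
apply: eq_integral => z _.
by rewrite likelihood_resample subr0 subr0 -muleA -EFinM mulrC.
Qed.

Lemma prob_likelihood mu n A : measurable A -> depends_on n A ->
  P mu A = \int[P 0%R]_x (\1_A x * likelihood mu n x)%:E.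
Proof.
move=> mA dA; rewrite -[in LHS](setIT A) -integral_indic//.
have dI : depends_on n (fun x => (\1_A x)%:E : \bar R).
  move=> x y xy; rewrite !indicE (_ : (x \in A) = (y \in A))//.
  by apply/idP/idP; rewrite !in_setE (dA _ _ xy).
rewrite (@change_of_measure mu n (fun x => (\1_A x)%:E))//.
by apply/measurable_EFinP; exact: measurable_indic.
Qed.

Lemma depends_on_setD n (A B : set (seqspace R)) :
  depends_on n A -> depends_on n B -> depends_on n (A `\` B).
Proof. by move=> dA dB x y xy; rewrite /setD/= (dA x y xy) (dB x y xy). Qed.

(* On [G] at least one of the two errors occurs; the inequality is then
   AM-GM applied to the densities, the geometric mean of the densities of
   [P a] and [P b] being a multiple of the density at the midpoint. *)
Lemma two_point_bound (a b t : R) n (G E E' : set (seqspace R)) :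
  (0 < t)%R -> measurable G -> measurable E -> measurable E' ->
  depends_on n G -> depends_on n E -> depends_on n E' -> E `&` E' = set0 ->
  (2 * expR (- (n%:R * (a - b) ^+ 2 / 8)))%:E * P ((a + b) / 2)%R G <=
  t%:E * (P a (G `\` E) + P b (G `\` E')) + (t^-1)%:E * (P a G + P b G).
Proof.
move=> t0 mG mE mE' dG dE dE' EE'.
have t0' : (0 < t^-1)%R by rewrite invr_gt0.
have c0 : (0 <= 2 * expR (- (n%:R * (a - b) ^+ 2 / 8)))%R.
  by rewrite mulr_ge0// expR_ge0.
have mW mu A : measurable A -> measurable_fun [set: seqspace R]
    (fun x => (\1_A x * likelihood mu n x)%:E).
  move=> mA; apply/measurable_EFinP; apply: measurable_funM.
    exact: measurable_indic.
  exact: measurable_likelihood.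
have W0 mu A x : 0 <= (\1_A x * likelihood mu n x)%:E.
  by rewrite lee_fin mulr_ge0// expR_ge0.
have mGE := measurableD mG mE; have mGE' := measurableD mG mE'.
rewrite !(@prob_likelihood _ n)//; do ?exact: depends_on_setD.
rewrite -!ge0_integralD//; do ?exact: mW.
rewrite -!ge0_integralZl ?lee_fin ?(ltW t0) ?(ltW t0')//; do ?[exact: mW
  | by apply: emeasurable_funD; exact: mW | by move=> x _; rewrite adde_ge0].
rewrite -ge0_integralD//; do ?[
  by apply: measurable_funeM; apply: emeasurable_funD; exact: mW
  | by move=> x _; rewrite mule_ge0 ?adde_ge0// lee_fin ltW].
apply: ge0_le_integral => //.
- by move=> x _; rewrite mule_ge0.
- by apply: measurable_funeM; exact: mW.
- by apply: emeasurable_funD; apply: measurable_funeM; apply: emeasurable_funD;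
    exact: mW.
move=> x _; rewrite -!(EFinM, EFinD) lee_fin !indicE.
pose r c : R := expR ((c * partial_sum n x - n%:R * c ^+ 2 / 2) / 2).
have likE c : likelihood c n x = (r c ^+ 2)%R.
  by rewrite /r -expRM_natl mulrC divfK.
have likM : (2 * expR (- (n%:R * (a - b) ^+ 2 / 8)) *
    likelihood ((a + b) / 2) n x = 2 * (r a * r b))%R.
  rewrite -mulrA /likelihood /r -!expRD; congr (_ * expR _)%R.
  by field.
have amgm p q : (2 * (p * q) <= t * p ^+ 2 + t^-1 * q ^+ 2)%R.
  rewrite -subr_ge0 (_ : _ - _ = t^-1 * (t * p - q) ^+ 2)%R.
    by rewrite mulr_ge0 ?sqr_ge0// ltW.
  by field; rewrite gt_eqF.
rewrite mulrCA likM !likE !in_setD.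
have [xG|_] := boolP (x \in G); last by rewrite /= !mul0r !addr0 !mulr0 addr0.
rewrite !mul1r /=.
have r2 c : (0 <= r c ^+ 2)%R by exact: sqr_ge0.
have tr2 c : (0 <= t * r c ^+ 2)%R by rewrite mulr_ge0// ltW.
have tr2' c : (0 <= t^-1 * r c ^+ 2)%R by rewrite mulr_ge0// ltW.
(* Off [E] the error counted under [a] occurs, and [t] weighs [r a ^+ 2]. On [E] disjointness forces
   the error counted under [b], and [a] and [b] exchange roles. *)
have [xE|_] := boolP (x \in E); last first.
  rewrite mul1r; have := amgm (r a) (r b).
  have : (0 <= t * ((x \notin E')%:R * r b ^+ 2))%R.
    by apply: mulr_ge0; [exact: ltW | exact: mulr_ge0].
  move: (tr2' a); rewrite !mulrDr; lra.
have -> : x \notin E'.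
  apply/negP; rewrite in_setE => xE'.
  suff : (E `&` E') x by rewrite EE'.
  by split => //; rewrite in_setE in xE.
rewrite mul0r add0r mul1r; have := amgm (r b) (r a).
move: (tr2' b); rewrite !mulrDr; lra.
Qed.

End change_of_measure.

(** * Estimates for the rate and the deterministic bound on the loss *)

Section rate.
Context {R : realType}.

Lemma ln2_ge : 2^-1 <= ln (2 : R).
Proof.
have : ln (1 + - 2^-1 : R) <= - 2^-1 by apply: le_ln1Dx; lra.
have -> : 1 + - 2^-1 = 2^-1 :> R by lra.
by rewrite lnV ?posrE// lerN2.
Qed.

(** This is e < 3: from exp(-1/6) >= 5/6 follows e <= (6/5)^6 < 3. It makes log log n positive from
    n = 3 on. *)
Lemma ln3_gt1 : 1 < ln (3 : R).
Proof.
have e6 : expR (6^-1 : R) <= 6 / 5.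
  rewrite -[leLHS]invrK -expRN -[leRHS]invrK lef_pV2 ?posrE ?expR_gt0//.
  by apply: le_trans (expR_ge1Dx _); lra.
rewrite -ltr_expR lnK ?posrE//.
have -> : expR 1 = expR (6^-1 : R) ^+ 6.
  by rewrite -expRM_natl divff.
apply: (@le_lt_trans _ _ ((6 / 5) ^+ 6)); first by rewrite lerXn2r ?nnegrE ?expR_ge0.
by lra.
Qed.

Lemma ln_nat_gt1 n : (2 < n)%N -> 1 < ln (n%:R : R).
Proof.
move=> n2; apply: (lt_le_trans ln3_gt1).
by rewrite ler_ln ?posrE ?ltr0n ?ler_nat//; exact: leq_trans n2.
Qed.

Lemma rate_gt0 n : 0 < rate n :> R.
Proof.
rewrite /rate; case: leqP => // n2.
by rewrite mulr_gt0 ?ln_gt0 ?ln_nat_gt1// invr_gt0 ltr0n (leq_trans _ n2).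
Qed.

Lemma ln_trunc_log_ge n : 2^-1 <= ln ((trunc_log 2 n + 2)%:R : R).
Proof.
by apply: (le_trans ln2_ge); rewrite ler_ln ?posrE ?ltr0n ?addn2// ler_nat.
Qed.

Lemma rate_dyadic_ge : exists2 c : R, 0 < c & forall n, (0 < n)%N ->
  c * ln (trunc_log 2 n + 2)%:R <= n%:R * rate n.
Proof.
have lnln3 : 0 < ln (ln 3) :> R by rewrite ln_gt0// ln3_gt1.
(* With this [D], [ln 4] equals [(D - 1) * ln (ln 3)] and is absorbed by [(D - 1) * ln (ln n)] for n
   >= 3. The 2 added to [D] below covers n <= 2, where the left-hand logarithm is at most
   [ln 4 <= 2]. *)
pose D : R := ln 4 / ln (ln 3) + 1.
have ln4 : 0 <= ln 4 :> R by rewrite ln_ge0// ler1n.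
have D1 : 1 <= D by rewrite lerDr divr_ge0// ltW.
have ln43 : ln 4 <= D * ln (ln 3) - ln (ln 3).
  by rewrite /D mulrDl mul1r addrK divfK// gt_eqF.
have D0 : 0 < D by exact: lt_le_trans D1.
have ln42 : ln 4 = 2 * ln 2 :> R.
  by rewrite (_ : 4 = 2 ^+ 2 :> R) ?lnXn ?mulr_natl//; lra.
have ln2_le : ln 2 <= 1 :> R by have := @le_ln1Dx R 1; apply; lra.
have D20 : 0 < D + 2 by lra.
exists (D + 2)^-1; first by rewrite invr_gt0.
move=> n n0; rewrite ler_pdivrMl//.
have [n2|n2] := leqP n 2.
  have kn : (trunc_log 2 n + 2 <= 4)%N.
    by move: n n0 n2 => [|[|[|]]].
  apply: (@le_trans _ _ (ln 4)).
    by rewrite ler_ln ?posrE ?ltr0n ?addn2// ler_nat -addn2.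
  rewrite /rate n2 mulr1.
  have n1 : 1 <= n%:R :> R by rewrite ler1n.
  apply: (@le_trans _ _ (2 * 1)); first by rewrite ln42; lra.
  by apply: ler_pM => //; lra.
have ln1 := ln_nat_gt1 n2; have lnn0 := lt_trans ltr01 ln1.
have n0' : 0 < n%:R :> R by rewrite ltr0n.
have lnln0 : 0 < ln (ln n%:R) :> R by rewrite ln_gt0.
rewrite /rate leqNgt n2 /= mulVKf ?gt_eqF//.
(* Let k be the binary logarithm: 2^k <= n and [ln 2 >= 1 / 2] give k <= 2 ln n, and 2 <= 2 ln n
   since ln n > 1. *)
have kn : ((trunc_log 2 n + 2)%:R : R) <= 4 * ln n%:R.
  have : ln ((2 ^ trunc_log 2 n)%:R : R) <= ln n%:R.
    by rewrite ler_ln ?posrE ?ltr0n ?expn_gt0// ler_nat trunc_logP.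
  rewrite natrX lnXn// -[ln _ *+ _]mulr_natl natrD => k2.
  have : (trunc_log 2 n)%:R * 2^-1 <= (trunc_log 2 n)%:R * ln 2 :> R.
    by rewrite ler_wpM2l// ln2_ge.
  lra.
apply: (@le_trans _ _ (ln (4 * ln n%:R))).
  by rewrite ler_ln// posrE; [rewrite ltr0n addn2|rewrite mulr_gt0].
rewrite lnM ?posrE//.
have : ln (ln 3) <= ln (ln n%:R) :> R.
  rewrite ler_ln ?posrE ?(lt_trans _ ln3_gt1)//.
  by rewrite ler_ln ?posrE// ler_nat.
have D1' : 0 <= D - 1 by rewrite subr_ge0.
by move=> /(ler_wpM2l D1'); lra.
Qed.

(** For y > 3 put v = l (y - 3) / 2, so that exp(v) <= sqrt(1 + q) and y - 3 <= 4 v. Then y^2 <= 18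
    + 2 (y - 3)^2 <= 18 + 32 v^2, and v^2 <= 2 exp(v) yields 82 = 18 + 64. *)
Lemma sqr_le_expR (l y q : R) : 2^-1 <= l -> 0 <= y ->
  expR (l * (y - 3)) <= q -> y ^+ 2 <= 82 * Num.sqrt (1 + q).
Proof.
move=> l2 y0 eq; have q0 : 0 <= q := le_trans (expR_ge0 _) eq.
have [y3|y3] := leP y 3.
  have s1 : 1 <= Num.sqrt (1 + q).
    by rewrite -[leLHS]sqrtr1 ler_wsqrtr// lerDl.
  have : y ^+ 2 <= 9 by rewrite (_ : 9 = 3 ^+ 2); [rewrite ler_sqr ?nnegrE|lra].
  lra.
pose v := l * (y - 3) / 2.
have v0 : 0 <= v by rewrite /v divr_ge0// mulr_ge0 ?subr_ge0 ?ltW//; lra.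
have ev : expR v <= Num.sqrt (1 + q).
  rewrite -[leLHS]ger0_norm ?expR_ge0// -sqrtr_sqr.
  rewrite ler_wsqrtr// -expRM_natl mulrC divfK//; lra.
have := @expR_ge1Dxn R v 1 v0; rewrite (_ : 2`! = 2)%N// => ev2.
have s0 : 0 <= y - 3 by rewrite subr_ge0 ltW.
have yv : y - 3 <= 4 * v by rewrite /v; nra.
have : (y - 3) ^+ 2 <= (4 * v) ^+ 2 by rewrite ler_sqr ?nnegrE// mulr_ge0.
rewrite exprMn; nra.
Qed.

Definition tilt (k : nat) : R := Num.sqrt (ln (k + 2)%:R / 2 ^+ k).

Lemma loss_le_tilt : exists2 D : R, 0 < D & forall n s, (0 < n)%N ->
  (s / n%:R) ^+ 2 / rate n <=
  D * Num.sqrt (1 + (trunc_log 2 n + 2)%:R ^- 2 *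
    expR (tilt (trunc_log 2 n) * `|s| - n%:R * tilt (trunc_log 2 n) ^+ 2 / 2)).
Proof.
have [c c0 rate_ge] := rate_dyadic_ge.
exists (82 / c); first by rewrite divr_gt0.
move=> n s n0; set k := trunc_log 2 n.
pose l : R := ln (k + 2)%:R; have l2 : 2^-1 <= l by exact: ln_trunc_log_ge.
have l0 : 0 < l by lra.
have n0' : 0 < n%:R :> R by rewrite ltr0n.
have nl0 : 0 < n%:R * l by rewrite mulr_gt0.
have nl0' : 0 < Num.sqrt (n%:R * l) by rewrite sqrtr_gt0.
pose y := `|s| / Num.sqrt (n%:R * l).
have y0 : 0 <= y by rewrite divr_ge0// ltW.
have y2 : y ^+ 2 = s ^+ 2 / (n%:R * l).
  by rewrite /y expr_div_n real_normK ?num_real// sqr_sqrtr// ltW.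
apply: (@le_trans _ _ (y ^+ 2 / c)).
  rewrite y2 expr_div_n -[leLHS]mulrA -[leRHS]mulrA ler_wpM2l ?sqr_ge0// -!invfM lef_pV2 ?posrE.
  - rewrite expr2 -!mulrA ler_wpM2l// ?[l * c]mulrC ?rate_ge// ltW.
  - by rewrite mulr_gt0 ?rate_gt0// exprn_gt0.
  - by rewrite !mulr_gt0.
rewrite [leRHS]mulrAC ler_wpM2r ?invr_ge0 ?(ltW c0)//.

apply: (@sqr_le_expR l) => //.
have k2 : 0 < (k + 2)%:R :> R by rewrite ltr0n addn2.
have -> : (k + 2)%:R ^- 2 = expR (- (l + l)) :> R.
  by rewrite expRN expRD lnK ?posrE// expr2.
rewrite -expRD ler_expR.
have p0 : 0 < 2 ^+ k :> R by rewrite exprn_gt0.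
have pn : 2 ^+ k <= n%:R :> R by rewrite -natrX ler_nat trunc_logP.
have np : n%:R <= 2 * 2 ^+ k :> R.
  by rewrite -exprS -natrX ler_nat ltnW// trunc_log_ltn.
have t2 : tilt k ^+ 2 = l / 2 ^+ k by rewrite sqr_sqrtr// divr_ge0// ltW.
have np' : n%:R / 2 ^+ k / 2 <= 1 :> R by rewrite !ler_pdivrMr//; lra.
have nt : n%:R * tilt k ^+ 2 / 2 <= l.
  by rewrite t2 mulrCA -[leLHS]mulrA ler_piMr// ltW.
have lt : l / Num.sqrt (n%:R * l) <= tilt k.
  rewrite ler_pdivrMr// /tilt -/l -sqrtrM ?divr_ge0 ?(ltW l0) ?(ltW p0)//.
  rewrite -[leLHS]ger0_norm ?(ltW l0)// -sqrtr_sqr ler_wsqrtr//.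
  rewrite (_ : _ * _ = n%:R / 2 ^+ k * l ^+ 2); last by field; rewrite gt_eqF.
  by rewrite ler_peMl ?sqr_ge0// ler_pdivlMr ?mul1r.
have ty : l * y <= tilt k * `|s|.
  by rewrite /y mulrCA mulrC ler_wpM2r.
by rewrite mulrBr; lra.
Qed.

End rate.

(** * Maximal inequality for the square root of a positive supermartingale *)

Section maximal_inequality.
Context {R : realType} (mu : R) (P : probability (seqspace R) R).
Hypothesis iidP : iid_normal1 mu P.
Variable m : nat -> seqspace R -> R.
Hypothesis mm : forall n, measurable_fun [set: seqspace R] (m n).
Hypothesis m0 : forall n x, 0 < m n x.
Hypothesis dm : forall n, depends_on n (m n).
Hypothesis super_m : forall n x,
  (\int[normal_prob mu 1]_z (m n.+1 (resample n (x, z)))%:E <= (m n x)%:E)%E.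

Fixpoint running_max (n : nat) (x : seqspace R) : R :=
  if n is n'.+1 then Num.max (running_max n' x) (m n x) else m 0 x.

Lemma running_max_ge n x : m n x <= running_max n x.
Proof. by case: n => //= n; rewrite le_max lexx orbT. Qed.

Lemma running_max_nd n n' x : (n <= n')%N -> running_max n x <= running_max n' x.
Proof.
elim: n' => [|n' IH]; first by rewrite leqn0 => /eqP ->.
rewrite leq_eqVlt => /predU1P[-> //|nn'].
by rewrite (le_trans (IH nn'))//= le_max lexx.
Qed.

Lemma running_max_gt0 n x : 0 < running_max n x.
Proof. exact: lt_le_trans (running_max_ge n x). Qed.

Lemma measurable_running_max n : measurable_fun [set: seqspace R] (running_max n).
Proof. by elim: n => //= n IH; exact: measurable_maxr. Qed.

Lemma depends_on_running_max n : depends_on n (running_max n).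
Proof.
elim: n => /= [|n IH] x y xy; first exact: dm.
rewrite (IH x y) => [|i ni]; first by rewrite (dm xy).
by apply: xy; exact: leq_trans (leqnSn n).
Qed.

Let sM n x := Num.sqrt (running_max n x).

Let sM_gt0 n x : 0 < sM n x. Proof. by rewrite sqrtr_gt0 running_max_gt0. Qed.

Lemma measurable_sqrt_running_max n :
  measurable_fun [set: seqspace R] (fun x => Num.sqrt (running_max n x)).
Proof.
apply: (measurableT_comp _ (measurable_running_max n)).
by apply: continuous_measurable_fun; exact: sqrt_continuous.
Qed.

Let V n x := sM n x + m n x / sM n x.

Let measurable_sMV n : measurable_fun [set: seqspace R] (fun x => (sM n x)^-1).
Proof.
have -> : (fun x => (sM n x)^-1) = (fun x => sM n x `^ (-1)).
  by apply/funext => x; rewrite powR_inv1// ltW.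
apply: (measurableT_comp (measurable_powR _)).
exact: measurable_sqrt_running_max.
Qed.

(* AM-GM when the running maximum increases at time [n.+1]. *)
Let V_step n x : V n.+1 x <= sM n x + m n.+1 x / sM n x.
Proof.
rewrite /V; have [le_mM|lt_Mm] := leP (m n.+1 x) (running_max n x).
  by rewrite /sM /= max_l.
have e : running_max n.+1 x = m n.+1 x by rewrite /= max_r// ltW.
have -> : m n.+1 x = sM n.+1 x ^+ 2 by rewrite /sM e sqr_sqrtr// ltW.
have a0 := sM_gt0 n x; have b0 := sM_gt0 n.+1 x.
set a := sM n x in a0 *; set b := sM n.+1 x in b0 *.
rewrite -subr_ge0 (_ : _ - _ = (a - b) ^+ 2 / a).
  by rewrite divr_ge0 ?sqr_ge0// ltW.
by field; rewrite !gt_eqF.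
Qed.

Local Open Scope ereal_scope.

(** The integral of [V n] dominates the left-hand side, does not increase with [n], and at time 0
    equals the right-hand side, both summands of [V 0] being the root of [m 0]. *)
Lemma sqrt_maximal_inequality n :
  \int[P]_x (Num.sqrt (running_max n x))%:E <=
  \int[P]_x (2 * Num.sqrt (m 0%N x))%:E.
Proof.
have mV k : measurable_fun [set: seqspace R] (fun x => (sM k x + m k x / sM k x)%:E).
  apply/measurable_EFinP; apply: measurable_funD.
    exact: measurable_sqrt_running_max.
  exact: measurable_funM.
have V0 k x : (0 <= V k x)%R.
  by rewrite addr_ge0 ?divr_ge0// ltW.
apply: (@le_trans _ _ (\int[P]_x (V n x)%:E)).
  apply: ge0_le_integral => //.

  - by apply/measurable_EFinP; exact: measurable_sqrt_running_max.
  - exact: mV.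
  - by move=> x _; rewrite lee_fin lerDl divr_ge0// ltW.
elim: n => [|n IH].
  rewrite le_eqVlt; apply/orP; left; apply/eqP/eq_integral => x _.
  congr EFin; rewrite /V /sM /= -{2}(sqr_sqrtr (ltW (m0 0 x))) expr2 mulfK.
    by rewrite mulr_natl.
  by rewrite gt_eqF// sqrtr_gt0.
apply: le_trans IH.
have mstep : measurable_fun [set: seqspace R]
    (fun x => (sM n x + m n.+1 x / sM n x)%:E).
  apply/measurable_EFinP; apply: measurable_funD.
    exact: measurable_sqrt_running_max.
  exact: measurable_funM.
have step0 x : (0 <= sM n x + m n.+1 x / sM n x)%R.
  by rewrite addr_ge0 ?divr_ge0// ltW.
apply: (@le_trans _ _ (\int[P]_x (sM n x + m n.+1 x / sM n x)%:E)).
  apply: ge0_le_integral => //.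
  - by move=> x _; rewrite lee_fin.
  - exact: mV.
  by move=> x _; rewrite lee_fin; exact: V_step.
(* The running maximum up to time [n] ignores coordinate [n], so redrawing it averages only
   [m n.+1], and [super_m] applies. *)
rewrite (ge0_integral_resample n iidP)//.
apply: ge0_le_integral => //.
- by move=> x _; apply: integral_ge0 => z _; rewrite lee_fin.
- by apply: (@measurable_integral_resample _ mu n (fun x => (sM n x + m n.+1 x / sM n x)%:E)).
- exact: mV.
move=> x _.
have sMr z : sM n (resample n (x, z)) = sM n x.
  by rewrite /sM (depends_on_resample _ _ (leqnn n) (@depends_on_running_max n)).
have mr : measurable_fun [set: R] (fun z => (m n.+1 (resample n (x, z)))%:E).
  apply/measurable_EFinP; apply: measurableT_comp => //.
  exact: measurable_resample2.
under eq_integral => z _ do rewrite sMr EFinD mulrC EFinM.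
rewrite ge0_integralD//; first last.
- exact: measurable_funeM.
- by move=> z _; rewrite -EFinM lee_fin mulr_ge0 ?invr_ge0// ltW.
- by move=> z _; rewrite lee_fin ltW.
rewrite probability_integral_cst /V EFinD leeD2l// ge0_integralZl//; first last.
- by rewrite lee_fin invr_ge0 ltW.
- by move=> z _; rewrite lee_fin ltW.
by rewrite mulrC EFinM lee_wpmul2l// lee_fin invr_ge0 ltW.
Qed.

End maximal_inequality.

(** * The mixture martingale and the loss of the empirical mean *)

Section upper_bound.
Context {R : realType} (mu : R) (P : probability (seqspace R) R).
Hypothesis iidP : iid_normal1 mu P.

(** The exponential martingale of the centred walk, that is, the likelihood ratio of mean [mu + t]
    against mean [mu]. *)
Definition tilted (t : R) (n : nat) (x : seqspace R) : R :=
  expR (t * (partial_sum n x - n%:R * mu) - n%:R * t ^+ 2 / 2).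

Lemma measurable_tilted t n : measurable_fun [set: seqspace R] (tilted t n).
Proof.
apply: measurableT_comp => //; apply: measurable_funB => //.
apply: measurable_funM => //; apply: measurable_funB => //.
exact: measurable_partial_sum.
Qed.

Lemma depends_on_tilted t n : depends_on n (tilted t n).
Proof. by move=> x y xy; rewrite /tilted (depends_on_partial_sum xy). Qed.

Lemma tilted_resample t n x z : tilted t n.+1 (resample n (x, z)) =
  tilted t n x * expR (t * (z - mu) - t ^+ 2 / 2).
Proof.
rewrite /tilted partial_sum_resample -expRD -natr1; congr expR.
by field.
Qed.

Lemma integral_tilted_resample t n x :
  (\int[normal_prob mu 1]_z (tilted t n.+1 (resample n (x, z)))%:E =
   (tilted t n x)%:E)%E.
Proof.
under eq_integral => z _ do rewrite tilted_resample EFinM.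
rewrite ge0_integralZl//; first by rewrite integral_normal_expR mule1.
- apply/measurable_EFinP; apply: measurableT_comp => //.
  apply: measurable_funB => //; apply: measurable_funM => //.
  exact: measurable_funB.
- by rewrite lee_fin expR_ge0.
Qed.

(** The sum is cut at [K] to avoid an infinite series; the bound on its initial value is uniform in
    [K]. *)
Definition mixture (K n : nat) (x : seqspace R) : R :=
  1 + \sum_(k < K) (k + 2)%:R ^- 2 *
        (tilted (tilt k) n x + tilted (- tilt k) n x).

Let mixture_term_ge0 k n x :
  0 <= (k + 2)%:R ^- 2 * (tilted (tilt k) n x + tilted (- tilt k) n x) :> R.
Proof. by rewrite mulr_ge0 ?invr_ge0 ?exprn_ge0// addr_ge0// expR_ge0. Qed.

Let measurable_mixture_term k n : measurable_fun [set: seqspace R]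
  (fun x => (k + 2)%:R ^- 2 * (tilted (tilt k) n x + tilted (- tilt k) n x) : R).
Proof.
by apply: measurable_funM => //; apply: measurable_funD; exact: measurable_tilted.
Qed.

Lemma mixture_gt0 K n x : 0 < mixture K n x.
Proof. by rewrite ltr_pwDl// sumr_ge0. Qed.

Lemma measurable_mixture K n : measurable_fun [set: seqspace R] (mixture K n).
Proof. by apply: measurable_funD => //; exact: measurable_sum. Qed.

Lemma depends_on_mixture K n : depends_on n (mixture K n).
Proof.
move=> x y xy; congr (1 + _); apply: eq_bigr => k _.
by rewrite !(depends_on_tilted _ xy).
Qed.

Lemma integral_mixture_resample K n x :
  (\int[normal_prob mu 1]_z (mixture K n.+1 (resample n (x, z)))%:E =
   (mixture K n x)%:E)%E.
Proof.
have mr := @measurable_resample2 R n x.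
have mt t : measurable_fun [set: R] (fun z => tilted t n.+1 (resample n (x, z))).
  by apply: measurableT_comp => //; exact: measurable_tilted.
have mEt t : measurable_fun [set: R] (fun z => (tilted t n.+1 (resample n (x, z)))%:E).
  exact/measurable_EFinP.
have mterm k : measurable_fun [set: R] (fun z => ((k + 2)%:R ^- 2 *
    (tilted (tilt k) n.+1 (resample n (x, z)) +
     tilted (- tilt k) n.+1 (resample n (x, z))))%:E).
  apply/measurable_EFinP; apply: measurable_funM => //.
  exact: measurable_funD.
under eq_integral => z _ do rewrite EFinD -sumEFin.
rewrite ge0_integralD//; first last.
- by apply: emeasurable_sum => k; exact: (mterm k).
- by move=> z _; apply: sume_ge0 => k _; rewrite lee_fin.
rewrite probability_integral_cst ge0_integral_sum//; last 2 first.
- by move=> k; exact: (mterm k).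
- by move=> k z _; rewrite lee_fin.
rewrite /mixture EFinD -sumEFin; congr (_ + _)%E; apply: eq_bigr => k _.
under eq_integral => z _ do rewrite EFinM EFinD.
rewrite ge0_integralZl//; do ?[by rewrite lee_fin invr_ge0 exprn_ge0
  | apply: emeasurable_funD; exact: mEt
  | by move=> z _; rewrite -EFinD lee_fin addr_ge0// expR_ge0].
rewrite ge0_integralD//; do ?[by move=> z _; rewrite lee_fin expR_ge0 | exact: mEt].
by rewrite EFinM EFinD !integral_tilted_resample.
Qed.

Lemma sum_inv_sqr_le1 K : \sum_(k < K) (k + 2)%:R ^- 2 <= 1 :> R.
Proof.
(* Strengthened for the induction: each term is at most 1/(k+1) - 1/(k+2). *)
suff : \sum_(k < K) (k + 2)%:R ^- 2 <= 1 - K.+1%:R^-1 :> R.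
  by move/le_trans; apply; rewrite lerBlDr lerDl invr_ge0.
elim: K => [|K IH]; first by rewrite big_ord0 invr1 subrr.
rewrite big_ord_recr /= (le_trans (lerD IH (lexx _)))// addn2.
rewrite -natr1; set k : R := K.+1%:R; have k0 : 0 < k by rewrite ltr0n.
rewrite -subr_ge0 (_ : _ - _ = (k * (k + 1) ^+ 2)^-1).
  by rewrite invr_ge0 mulr_ge0 ?exprn_ge0// ?addr_ge0// ltW.
by field; rewrite !gt_eqF// addr_gt0.
Qed.

Lemma mixture0_le K x : mixture K 0 x <= 3.
Proof.
have t0 t : tilted t 0 x = 1.
  by rewrite /tilted /partial_sum big_ord0 !mul0r subrr mulr0 subrr expR0.
rewrite /mixture; under eq_bigr do rewrite !t0.
by rewrite -mulr_suml; have := sum_inv_sqr_le1 K; lra.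
Qed.

(** All terms are nonnegative; only the [k]-th is kept, and in it the tilt with the sign of the
    deviation. *)
Lemma mixture_ge K k n x : (k < K)%N ->
  1 + (k + 2)%:R ^- 2 *
    expR (tilt k * `|partial_sum n x - n%:R * mu| - n%:R * tilt k ^+ 2 / 2)
  <= mixture K n x.
Proof.
move=> kK; rewrite lerD2l (bigD1 (Ordinal kK))//= -[leLHS]addr0.
rewrite lerD ?sumr_ge0// ler_wpM2l ?invr_ge0 ?exprn_ge0//.
have [s0|s0] := ger0P (partial_sum n x - n%:R * mu).
  by rewrite lerDl expR_ge0.
by rewrite mulrN -mulNr -(sqrrN (tilt k)) lerDr expR_ge0.
Qed.

Lemma mle_loss n x : (0 < n)%N ->
  scaled_loss (@mle R) rate mu n x =
  ((partial_sum n x - n%:R * mu) / n%:R) ^+ 2 / rate n.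
Proof.
move=> n0; rewrite /scaled_loss /mle -sqrrN; congr (_ ^+ 2 / _).
have -> : \sum_(i < n) tnth (obs n x) i = partial_sum n x.
  by apply: eq_bigr => i _; rewrite tnth_mktuple.
by field; rewrite pnatr_eq0 -lt0n.
Qed.

Lemma measurable_mle_loss n :
  measurable_fun [set: seqspace R] (scaled_loss (@mle R) rate mu n.+1).
Proof.
rewrite (_ : scaled_loss _ _ _ _ = fun x =>
  ((partial_sum n.+1 x - n.+1%:R * mu) / n.+1%:R) ^+ 2 / rate n.+1); last first.
  by apply/funext => x; rewrite mle_loss.
apply: measurable_funM => //; apply: measurable_funX.
apply: measurable_funM => //; apply: measurable_funB => //.
exact: measurable_partial_sum.
Qed.

End upper_bound.

(** * Upper bound on the risk by monotone convergence *)

Section mle_risk.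
Context {R : realType}.
Local Open Scope ereal_scope.

Lemma sup_risk_mle_le : exists2 C : R, (0 < C)%R &
  forall (P : R -> probability (seqspace R) R) mu, iid_normal1 mu (P mu) ->
    sup_risk P (@mle R) rate mu <= C%:E.
Proof.
have [D D0 lossD] := @loss_le_tilt R.
(* [D] comes from the pointwise bound, and [2 * Num.sqrt 3] from the maximal inequality with initial
   value at most 3. *)
exists (D * (2 * Num.sqrt 3))%R => [|P mu iidP].
  by rewrite !mulr_gt0// sqrtr_gt0.
pose loss n x := (scaled_loss (@mle R) rate mu n.+1 x)%:E.
(* Maximum of the first [N] losses. The initial 0 does not alter the limit, losses being
   nonnegative. *)
pose G := fix G N x : \bar R := if N is N'.+1 then maxe (G N' x) (loss N' x) else 0.
have mloss n : measurable_fun [set: seqspace R] (loss n).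
  by apply/measurable_EFinP; exact: measurable_mle_loss.
have GS N x : G N.+1 x = maxe (G N x) (loss N x) by [].
have mG N : measurable_fun [set: seqspace R] (G N).
  by elim: N => [|N IH]; [exact: measurable_cst|exact: measurable_maxe].
have G0 N x : 0 <= G N x.
  by elim: N => [//|N IH]; rewrite GS le_max IH.
have G_lub N x y : 0 <= y -> (forall n, (n < N)%N -> loss n x <= y) -> G N x <= y.
  move=> y0; elim: N => [//|N IH] ly; rewrite GS ge_max ly// andbT.
  by apply: IH => n nN; apply: ly; exact: leqW.
have ndG x : nondecreasing_seq (G ^~ x).
  by apply/nondecreasing_seqP => N; rewrite GS le_max lexx.
have G_le N x : G N x <=
    (D * Num.sqrt (running_max (mixture mu N.+1) N x))%:E.
  apply: G_lub => [|n nN]; first by rewrite lee_fin mulr_ge0 ?sqrtr_ge0// ltW.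
  rewrite lee_fin mle_loss//.
  apply: (le_trans (lossD n.+1 _ isT)); rewrite ler_wpM2l ?(ltW D0)//.
  rewrite ler_wsqrtr//.
  (* A sample size at most [N] uses a tilt of index at most [N], so a mixture of [N.+1] terms
     contains it. *)
  have kN : (trunc_log 2 n.+1 < N.+1)%N.
    rewrite ltnS ltnW// (leq_trans (ltn_expl _ (ltnSn 1)))//.
    by rewrite (leq_trans (trunc_logP _ _)).
  apply: (le_trans (mixture_ge mu n.+1 x kN)).
  exact: le_trans (running_max_ge _ _ _) (running_max_nd _ _ nN).
have IG N : \int[P mu]_x G N x <= (D * (2 * Num.sqrt 3))%:E.
  have mR : measurable_fun [set: seqspace R]
      (fun x => (Num.sqrt (running_max (mixture mu N.+1) N x))%:E).
    apply/measurable_EFinP; apply: measurable_sqrt_running_max => n.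
    exact: measurable_mixture.
  apply: (@le_trans _ _ (\int[P mu]_x (D%:E *
      (Num.sqrt (running_max (mixture mu N.+1) N x))%:E))).
    by apply: ge0_le_integral => //; exact: measurable_funeM.
  rewrite ge0_integralZl//; do ?[by move=> x _; rewrite lee_fin sqrtr_ge0
    | by rewrite lee_fin ltW].
  rewrite EFinM lee_wpmul2l ?lee_fin ?(ltW D0)//.
  apply: (le_trans (@sqrt_maximal_inequality _ mu _ iidP _ _ _ _ _ N)).
  - by move=> n; exact: measurable_mixture.
  - by move=> n x; exact: mixture_gt0.
  - by move=> n; exact: depends_on_mixture.
  - by move=> n x; rewrite integral_mixture_resample.
  rewrite -[leRHS](probability_integral_cst (P mu)).
  apply: ge0_le_integral => //.
  - apply/measurable_EFinP; apply: measurable_funM => //.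
    apply: measurableT_comp (measurable_mixture _ _ _).
    by apply: continuous_measurable_fun; exact: sqrt_continuous.
  - by move=> x _; rewrite lee_fin ler_wpM2l// ler_wsqrtr// mixture0_le.
rewrite /sup_risk.
have supG x : ereal_sup [set (scaled_loss (@mle R) rate mu n x)%:E |
    n in [set n | (0 < n)%N]] = limn (G ^~ x).
  rewrite (cvg_lim _ (ereal_nondecreasing_cvgn (ndG x)))//.
  apply/eqP; rewrite eq_le; apply/andP; split.
    apply: ge_ereal_sup => _ [[//|n] _ <-].
    apply: (@le_trans _ _ (G n.+1 x)); last by apply: ereal_sup_ubound; exists n.+1.
    by rewrite GS le_max lexx orbT.
  apply: ge_ereal_sup => _ [N _ <-]; apply: G_lub.
    apply: (@le_trans _ _ (loss 0%N x)).
      by rewrite lee_fin divr_ge0 ?sqr_ge0// ltW// rate_gt0.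
    by apply: ereal_sup_ubound; exists 1%N.
  by move=> n nN; apply: ereal_sup_ubound; exists n.+1.
under eq_integral do rewrite supG.
rewrite monotone_convergence//.
apply: lime_le; last by near=> N; exact: IG.
apply: ereal_nondecreasing_is_cvgn => N N' NN'.
by apply: ge0_le_integral => // x _; exact: ndG.
Unshelve. all: by end_near. Qed.

End mle_risk.

(** * Binary tree of means and the bound on its affinities *)

Section tree_bound.
Context {R : realType}.
Variable P : R -> probability (seqspace R) R.
Hypothesis iidP : forall mu, iid_normal1 mu (P mu).
Variables (K : nat) (n : 'I_K -> nat) (T : 'I_K -> seqspace R -> R).
Variable delta : 'I_K -> R.
Hypothesis n_nd : forall i j : 'I_K, (i <= j)%N -> (n i <= n j)%N.
Hypothesis mT : forall i, measurable_fun [set: seqspace R] (T i).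
Hypothesis dT : forall i, depends_on (n i) (T i).
Hypothesis delta_gt0 : forall i, 0 < delta i.
Hypothesis delta_tail : forall j : 'I_K,
  \sum_(i < K | (j < i)%N) delta i <= delta j / 4.

Definition accurate (nu : R) : set (seqspace R) :=
  [set x | forall i, `|nu - T i x| < delta i / 4].

Hypothesis accurate_likely : forall nu, ((3 / 4)%:E <= P nu (accurate nu))%E.

Let sign_seq := {ffun 'I_K -> bool}.

Definition leaf (e : sign_seq) : R := \sum_(i < K) (e i)%:R * delta i.

(** Ancestor of [leaf e] at depth [j], with coefficient [j] included. *)
Definition node (e : sign_seq) (j : 'I_K) : R :=
  \sum_(i < K | (i <= j)%N) (e i)%:R * delta i.

Definition flip (j : 'I_K) (e : sign_seq) : sign_seq :=
  [ffun i => e i (+) (i == j)].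

(** Siblings at depth [j] are [delta j] apart, so at radius [delta j / 2] their open balls are
    disjoint. *)
Definition located (e : sign_seq) (j : 'I_K) : set (seqspace R) :=
  [set x | `|T j x - node e j| < delta j / 2].

Definition located_before (e : sign_seq) (j : nat) : set (seqspace R) :=
  [set x | forall i : 'I_K, (i < j)%N -> located e i x].

Lemma flipK j : involutive (flip j).
Proof. by move=> e; apply/ffunP => i; rewrite !ffunE -addbA addbb addbF. Qed.

Lemma node_flip e (i j : 'I_K) : (i < j)%N -> node (flip j e) i = node e i.
Proof.
move=> ij; apply: eq_bigr => k ki; rewrite ffunE.
have -> : (k == j) = false.
  by apply/negbTE; rewrite neq_ltn (leq_ltn_trans ki ij).
by rewrite addbF.
Qed.

Lemma node_flip_diff e (j : 'I_K) : `|node e j - node (flip j e) j| = delta j.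
Proof.
have E u : node u j = (u j)%:R * delta j +
    \sum_(i < K | (i < j)%N) (u i)%:R * delta i.
  rewrite /node (bigD1 j)//=; congr (_ + _); apply: eq_bigl => i.
  by rewrite ltn_neqAle andbC.
rewrite !E [in X in _ - (_ + X)](eq_bigr (fun i => (e i)%:R * delta i)); last first.
  by move=> i ij; rewrite ffunE -val_eqE /= (ltn_eqF ij) addbF.
rewrite ffunE eqxx addbT [X in `|X|](_ : _ = (e j)%:R * delta j - (~~ e j)%:R * delta j).
  case: (e j) => /=; rewrite mul1r mul0r ?subr0 ?sub0r ?normrN gtr0_norm//.
by ring.
Qed.

Lemma leaf_flip_diff e (j : 'I_K) : `|leaf e - leaf (flip j e)| = delta j.
Proof.
have E u : leaf u = (u j)%:R * delta j +
    \sum_(i < K | i != j) (u i)%:R * delta i by rewrite /leaf (bigD1 j).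
rewrite !E [in X in _ - (_ + X)](eq_bigr (fun i => (e i)%:R * delta i)); last first.
  by move=> i ij; rewrite ffunE (negbTE ij) addbF.
rewrite ffunE eqxx addbT [X in `|X|](_ : _ = (e j)%:R * delta j - (~~ e j)%:R * delta j).
  case: (e j) => /=; rewrite mul1r mul0r ?subr0 ?sub0r ?normrN gtr0_norm//.
by ring.
Qed.

Lemma leaf_node e j : `|leaf e - node e j| <= delta j / 4.
Proof.
have -> : leaf e - node e j = \sum_(i < K | (j < i)%N) (e i)%:R * delta i.
  rewrite /leaf (bigID (fun i : 'I_K => (i <= j)%N))/= -/(node e j).
  by rewrite addrAC subrr add0r; apply: eq_bigl => i; rewrite ltnNge.
apply: le_trans (delta_tail j); apply: (le_trans (ler_norm_sum _ _ _)).
apply: ler_sum => i _; rewrite normrM normr_nat (gtr0_norm (delta_gt0 i)).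
by rewrite ler_piMl ?(ltW (delta_gt0 i))// lern1 leq_b1.
Qed.

Lemma measurable_near c r j : measurable [set x | `|T j x - c| < r].
Proof.
rewrite (_ : [set x | _] = setT `&` T j @^-1` `]c - r, c + r[).
  by apply: mT => //; exact: measurable_itv.
rewrite setTI; apply/seteqP.
by split => x /=; rewrite in_itv /= ltr_distl.
Qed.

Lemma measurable_located e j : measurable (located e j).
Proof. exact: measurable_near. Qed.

Lemma measurable_accurate nu : measurable (accurate nu).
Proof.
rewrite (_ : accurate nu =
  \bigcap_(i in [set: 'I_K]) [set x | `|T i x - nu| < delta i / 4]).
  apply: fin_bigcap_measurable => // i _; exact: measurable_near.
by apply/seteqP; split => x xn i; [move=> _|]; rewrite /= distrC; exact: xn.
Qed.

Lemma depends_on_located e j : depends_on (n j) (located e j).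
Proof. by move=> x y xy; rewrite /located /= (dT xy). Qed.

Lemma located_before0 e : located_before e 0 = setT.
Proof. by apply/seteqP; split. Qed.

Lemma located_beforeS e (j : 'I_K) :
  located_before e j.+1 = located_before e j `&` located e j.
Proof.
apply/seteqP; split => [x xj|x [xj xj'] i].
  by split => [i ij|]; apply: xj => //; exact: leqW.
by rewrite ltnS leq_eqVlt => /predU1P[/val_inj ->//|]; exact: xj.
Qed.

Lemma measurable_located_before e j : (j <= K)%N ->
  measurable (located_before e j).
Proof.
elim: j => [|j IH] jK; first by rewrite located_before0.
rewrite (located_beforeS e (Ordinal jK)); apply: measurableI.
  by apply: IH; exact: ltnW.
exact: measurable_located.
Qed.

Lemma depends_on_located_before e (j : 'I_K) :
  depends_on (n j) (located_before e j).
Proof.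
move=> x y xy; apply/propext; split => xj i ij.
  by rewrite -(depends_onW (n_nd (ltnW ij)) (@depends_on_located e i) xy); exact: xj.
by rewrite (depends_onW (n_nd (ltnW ij)) (@depends_on_located e i) xy); exact: xj.
Qed.

Lemma located_before_flip e (j : 'I_K) :
  located_before (flip j e) j = located_before e j.
Proof.
by apply/seteqP; split => x xj i ij; have := xj i ij; rewrite /located /= node_flip.
Qed.

Lemma located_flip e j : located e j `&` located (flip j e) j = set0.
Proof.
apply/seteqP; split => // x [] /=; rewrite /located /= => xe xe'.
have := ler_distD (T j x) (node e j) (node (flip j e) j).
by rewrite node_flip_diff (distrC (node e j)); lra.
Qed.

Definition pr (nu : R) (A : set (seqspace R)) : R := fine (P nu A).

Lemma prE nu A : measurable A -> (pr nu A)%:E = P nu A.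
Proof. by move=> mA; rewrite /pr fineK// fin_num_measure. Qed.

Lemma pr_le1 nu A : measurable A -> pr nu A <= 1.
Proof. by move=> mA; rewrite -lee_fin prE// probability_le1. Qed.

(** An accuracy of [delta i / 4] plus a distance [delta i / 4] to the node makes [delta i / 2]. The
    mean [nu] need not be a leaf, since midpoints of leaves are used as well. *)
Lemma pr_located_before nu e j : (j <= K)%N ->
  (forall i : 'I_K, (i < j)%N -> `|nu - node e i| <= delta i / 4) ->
  3 / 4 <= pr nu (located_before e j).
Proof.
move=> jK nu_e; have mG := measurable_located_before e jK.
rewrite -lee_fin prE//; apply: (le_trans (accurate_likely nu)).
apply: le_measure; rewrite ?inE//; first exact: measurable_accurate.
move=> x xnu i ij; rewrite /located /=.
have := ler_distD nu (T i x) (node e i).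
have := nu_e i ij; have := xnu i; rewrite (distrC nu (T i x)); lra.
Qed.

Lemma pr_setD nu e (j : 'I_K) : pr nu (located_before e j `\` located e j) =
  pr nu (located_before e j) - pr nu (located_before e j.+1).
Proof.
have mG := measurable_located_before e (ltnW (ltn_ord j)).
have mGS := measurable_located_before e (ltn_ord j).
have mE := measurable_located e j.
apply: EFin_inj; rewrite EFinB !prE//; last exact: measurableD.
rewrite located_beforeS in mGS *; rewrite measureD//.
by rewrite (le_lt_trans (probability_le1 _ _)) ?ltry.
Qed.

Lemma error_ge e (j : 'I_K) :
  expR (- ((n j)%:R * delta j ^+ 2 / 4)) / 4 <=
  pr (leaf e) (located_before e j `\` located e j) +
  pr (leaf (flip j e))
    (located_before (flip j e) j `\` located (flip j e) j).
Proof.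
set G := located_before e j; rewrite located_before_flip -/G.
set a := leaf e; set b := leaf (flip j e).
set E := located e j; set E' := located (flip j e) j.
have mG : measurable G := measurable_located_before e (ltnW (ltn_ord j)).
have mE : measurable E := measurable_located e j.
have mE' : measurable E' := measurable_located (flip j e) j.
pose k := expR (- ((n j)%:R * (a - b) ^+ 2 / 8)).
have k0 : 0 < k by exact: expR_gt0.
have k2 : k ^+ 2 = expR (- ((n j)%:R * delta j ^+ 2 / 4)).
  rewrite /k -expRM_natl -(real_normK (num_real (a - b))) leaf_flip_diff.
  by congr expR; field.
(* Before depth [j] both leaves have the same ancestors, and their midpoint is as close to these as
   they are. *)
have mid : 3 / 4 <= pr ((a + b) / 2) G.
  apply: pr_located_before => [|i ij]; first exact/ltnW.
  have -> : (a + b) / 2 - node e i = (a - node e i) / 2 + (b - node e i) / 2.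
    by field.
  have := leaf_node e i; have := leaf_node (flip j e) i; rewrite node_flip//.
  rewrite -/a -/b => hb ha; apply: (le_trans (ler_normD _ _)).
  by rewrite !normrM (ger0_norm (_ : 0 <= 2^-1))//; lra.
(* With t = 2 / k the bound reads 3 k / 2 <= 2 s / k + k, that is, s >= k^2 / 4. *)
have t0 : 0 < 2 / k by rewrite divr_gt0.
have := two_point_bound iidP a b t0 mG mE mE' (@depends_on_located_before e j)
  (@depends_on_located e j) (@depends_on_located (flip j e) j) (located_flip e j).
rewrite -/k -!prE//; do ?exact: measurableD.
rewrite -!(EFinM, EFinD) lee_fin -k2.
have := pr_le1 a mG; have := pr_le1 b mG.
set s := _ + pr b (G `\` E'); move=> b1 a1 bound.
have : 2 * k * (3 / 4) <= 2 / k * s + (2 / k)^-1 * 2.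
  apply: (@le_trans _ _ (2 * k * pr ((a + b) / 2) G)).
    by rewrite ler_wpM2l// mulr_ge0// ltW.
  apply: (le_trans bound); rewrite lerD2l ler_wpM2l ?invr_ge0 ?(ltW t0)//; lra.
rewrite invf_div mulrAC ler_pdivrMr//.
have -> : 2 / k * s = 2 * (s / k) by field; rewrite gt_eqF.
have {2}-> : s = s / k * k by rewrite divfK// gt_eqF.
by move=> bk; rewrite expr2 mulrAC ler_wpM2r ?(ltW k0)//; lra.
Qed.

(** The first misses at the various depths are disjoint; their probabilities telescope to that of
    some miss, at most 1 - 3/4. *)
Lemma sum_error_le e :
  \sum_(j < K) pr (leaf e) (located_before e j `\` located e j) <= 1 / 4.
Proof.
under eq_bigr do rewrite pr_setD.
rewrite -(big_mkord predT (fun j =>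
  pr (leaf e) (located_before e j) - pr (leaf e) (located_before e j.+1))).
rewrite (@telescope_sumr_eq _ 0 K (fun j => - pr (leaf e) (located_before e j)))//.
  have : 3 / 4 <= pr (leaf e) (located_before e K).
    by apply: pr_located_before => // i _; exact: leaf_node.
  by have := pr_le1 (leaf e) (measurable_located_before e (leq0n K)); lra.
by move=> j _; rewrite opprK addrC.
Qed.

(* Averaging over all leaves, flipping the [j]-th sign permutes them. *)
Lemma tree_bound : \sum_(j < K) expR (- ((n j)%:R * delta j ^+ 2 / 4)) <= 2.
Proof.
pose err e (j : 'I_K) := pr (leaf e) (located_before e j `\` located e j).
pose N : R := #|{: sign_seq}|%:R.
have sumN c : \sum_(e : sign_seq) c = N * c by rewrite sumr_const mulr_natl.
have N0 : 0 < N by rewrite ltr0n; apply/card_gt0P; exists [ffun=> false].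
have le_err j : N * expR (- ((n j)%:R * delta j ^+ 2 / 4)) / 4 <=
    2 * \sum_e err e j.
  have -> : 2 * \sum_e err e j = \sum_e (err e j + err (flip j e) j).
    rewrite big_split /= [X in _ + X](_ : _ = \sum_e err e j); last first.
      by rewrite [RHS](reindex_inj (inv_inj (flipK j))).
    by ring.
  rewrite -mulrA -sumN.
  by apply: ler_sum => e _; exact: error_ge.
have : \sum_j (N * expR (- ((n j)%:R * delta j ^+ 2 / 4)) / 4) <=
    \sum_j (2 * \sum_e err e j) by apply: ler_sum.
rewrite -mulr_sumr -mulr_suml -mulr_sumr exchange_big /=.
have : \sum_e \sum_j err e j <= N * (1 / 4).
  rewrite -sumN; apply: ler_sum => e _; exact: sum_error_le.
move=> h1 h2; rewrite -(ler_pM2l N0); lra.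
Qed.

End tree_bound.

(** * The grid of sample sizes 64^k and its gaps *)

Section geometric_grid.
Context {R : realType}.

Definition gap (k : nat) : R := 2 * Num.sqrt (rate (64 ^ k)%N).

Lemma gap_gt0 k : 0 < gap k.
Proof. by rewrite mulr_gt0 ?sqrtr_gt0 ?rate_gt0. Qed.

Lemma gap_sqr k : gap k ^+ 2 = 4 * rate (64 ^ k)%N.
Proof. by rewrite exprMn sqr_sqrtr ?(ltW (rate_gt0 _))//; lra. Qed.

Lemma ln64_ge3 : 3 <= ln (64 : R).
Proof.
have -> : 64 = 2 ^+ 6 :> R by lra.
by rewrite lnXn// -mulr_natl; have := @ln2_ge R; lra.
Qed.

Lemma expn64_gt2 k : (2 < 64 ^ k.+1)%N.
Proof. by rewrite expnS (@leq_trans (64 * 1))// leq_mul2l expn_gt0. Qed.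

Lemma rate_expn64 k :
  rate (64 ^ k.+1)%N = ln (k.+1%:R * ln 64) / 64 ^+ k.+1 :> R.
Proof.
rewrite /rate leqNgt expn64_gt2 /= natrX lnXn ?ltr0n//.
by rewrite -[ln _ *+ _]mulr_natl mulrC.
Qed.

(** After squaring: one step at most doubles the iterated logarithm and multiplies the denominator
    by 64, and 25 * 2 <= 64. Exponents start at 1, as [rate 1] does not follow the log log
    formula. *)
Lemma gapS k : 5 * gap k.+2 <= gap k.+1.
Proof.
rewrite -(ler_pXn2r (isT : (0 < 2)%N)) ?nnegrE ?mulr_ge0 ?(ltW (gap_gt0 _))//.
rewrite exprMn !gap_sqr !rate_expn64.
have l3 := ln64_ge3.
have k0 : 0 < k.+1%:R :> R by rewrite ltr0n.
have k1 : 1 <= k.+1%:R :> R by rewrite ler1n.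
have p0 : 0 < 64 ^+ k.+1 :> R by rewrite exprn_gt0.
have l0 : 0 < ln 64 :> R by lra.
have kl : 3 <= k.+1%:R * ln 64 :> R by nra.
set L := ln (k.+1%:R * ln 64).
have L2 : ln 2 <= L :> R by rewrite ler_ln ?posrE//; lra.
have LS : ln (k.+2%:R * ln 64) <= 2 * L.
  apply: (@le_trans _ _ (ln (2 * (k.+1%:R * ln 64)))).
    rewrite ler_ln ?posrE ?mulr_gt0 ?ltr0n// mulrA ler_wpM2r ?(ltW l0)//.
    by rewrite -natrM ler_nat mul2n -addnn -[leqLHS]addn1 leq_add2l.
  by rewrite lnM ?posrE ?mulr_gt0 ?ltr0n// -/L; lra.
rewrite [64 ^+ k.+2]exprS invfM mulrA !mulrA ler_wpM2r ?invr_ge0 ?(ltW p0)//.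
have : 0 < ln 2 :> R by rewrite ln_gt0//; lra.
lra.
Qed.

(** The ratio 5 is chosen because 1/5 + 1/25 + ... = 1/4. *)
Lemma geometric_tail (d : nat -> R) (j K : nat) :
  (forall i, 0 <= d i) -> (forall i, 5 * d i.+1 <= d i) ->
  \sum_(j.+1 <= i < K) d i <= d j / 4.
Proof.
move=> d0 dS; have [n] := ubnP (K - j)%N.
elim: n j => // n IH j Kj; have [jK|Kj'] := ltnP j.+1 K; last first.
  by rewrite big_geq// divr_ge0.
rewrite big_ltn//; have := dS j.
have : \sum_(j.+2 <= i < K) d i <= d j.+1 / 4 
  by apply: IH; rewrite -ltnS (leq_ltn_trans _ Kj)// ltn_sub2l// ltnW.
lra.
Qed.

Lemma gap_tail m K (j : 'I_K) :
  \sum_(i < K | (j < i)%N) gap (m.+1 + i) <= gap (m.+1 + j) / 4.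
Proof.
rewrite -(big_geq_mkord j.+1 K predT (fun i => gap (m.+1 + i))).
apply: (geometric_tail (d := fun i => gap (m.+1 + i))) => i.
  exact/ltW/gap_gt0.
by rewrite addnS addSn; exact: gapS.
Qed.

(** The factor 2 in [gap] makes the exponent exactly -log log n at n = 64^(k+1), so the value is 1 /
    log n, a multiple of a harmonic term. *)
Lemma affinity_gap k :
  expR (- ((64 ^ k.+1)%N%:R * gap k.+1 ^+ 2 / 4)) = k.+1%:R^-1 / ln 64 :> R.
Proof.
have k0 : 0 < k.+1%:R :> R by rewrite ltr0n.
have l0 : 0 < ln 64 :> R by have := ln64_ge3; lra.
have p0 : 0 < 64 ^+ k.+1 :> R by rewrite exprn_gt0.
rewrite gap_sqr rate_expn64 natrX -invfM.
rewrite (_ : _ / 4 = ln (k.+1%:R * ln 64)); last by field; rewrite gt_eqF.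
by rewrite expRN lnK// posrE mulr_gt0.
Qed.

Lemma harmonic_tail_unbounded m (B : R) :
  exists K, B < \sum_(i < K) (m.+1 + i)%:R^-1.
Proof.
apply: contrapT => /forallNP bounded; apply: (@dvg_harmonic R).
apply: nondecreasing_is_cvgn.
  apply/nondecreasing_seqP => n.
  by rewrite /series /= big_nat_recr//= lerDl invr_ge0.
exists (series harmonic m + B) => _ [n _ <-].
apply: (@le_trans _ _ (series harmonic (m + n)%N)).
  rewrite /series /= (big_cat_nat (leq0n n) (leq_addl m n)) /=.
  by rewrite lerDl sumr_ge0// => i _; rewrite invr_ge0.
rewrite /series /= (big_cat_nat (leq0n m) (leq_addr n m)) /= lerD2l.
rewrite -{1}[m]add0n big_addn addKn big_mkord.
have /negP := bounded n; rewrite -leNgt; apply: le_trans.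
by apply: ler_sum => i _; rewrite addSn addnC.
Qed.

End geometric_grid.

(** * Observations and the natural filtration *)

Section filtration.
Context {R : realType}.

Lemma measurable_obs n : measurable_fun [set: seqspace R] (@obs R n).
Proof.
apply/measurable_fun_tnthP => i.
rewrite (_ : _ \o _ = seqcoord i); first exact: measurable_seqcoord.
by apply/funext => x /=; rewrite tnth_mktuple.
Qed.

Lemma depends_on_obs n : depends_on n (@obs R n).
Proof.
move=> x y xy; apply: eq_from_tnth => i.
by rewrite !tnth_mktuple; exact: xy.
Qed.

Lemma natural_filtration_obs n (B : set (n.-tuple R)) : measurable B ->
  natural_filtration n (@obs R n @^-1` B).
Proof.
move=> mB; rewrite /natural_filtration.
rewrite (_ : (fun i : 'I_n => _) =
    fun i : 'I_n => (fun t : n.-tuple R => tnth t i) \o @obs R n).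
  by rewrite g_sigma_preimage_comp; exists B => //; rewrite setTI.
by apply/funext => i; apply/funext => x /=; rewrite tnth_mktuple.
Qed.

Lemma natural_filtration_nd n n' (A : set (seqspace R)) : (n <= n')%N ->
  natural_filtration n A -> natural_filtration n' A.
Proof.
move=> nn'; apply: sub_sigma_algebra2 => B.
rewrite -!bigcup_seq => -[i _ iB].
by exists (widen_ord nn' i) => //=; rewrite mem_index_enum.
Qed.

Lemma natural_filtrationT n : natural_filtration n [set: seqspace R].
Proof.
by rewrite -setC0; apply: sigma_algebraC; exact: sigma_algebra0.
Qed.

End filtration.

(** * Stopping at the first bad sample size *)

Section first_failure.
Context {R : realType}.
Variables (size : nat -> nat) (bad : nat -> seqspace R -> bool) (K : nat).
Hypothesis size_gt0 : forall i, (0 < size i)%N.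
Hypothesis size_nd : forall i j, (i <= j)%N -> (size i <= size j)%N.
Hypothesis bad_adapted : forall i, natural_filtration (size i) [set x | bad i x].

(** [find] returns [K] when no index is bad, so the rule below stops at [size K] at the latest and
    is finite everywhere. *)
Definition first_bad (x : seqspace R) : nat := find (bad ^~ x) (iota 0 K).

Definition first_failure (x : seqspace R) : option nat := Some (size (first_bad x)).

Lemma first_bad_le x : (first_bad x <= K)%N.
Proof. by rewrite (leq_trans (find_size _ _)) ?size_iota. Qed.

Lemma first_bad_min i x : (i < K)%N -> bad i x -> (first_bad x <= i)%N.
Proof.
move=> iK bi; rewrite leqNgt; apply/negP => /(before_find 0%N).
by rewrite nth_iota// add0n bi.
Qed.

Lemma first_badP x : (first_bad x < K)%N -> bad (first_bad x) x.
Proof.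
move=> fK; have : has (bad ^~ x) (iota 0 K) by rewrite has_find size_iota.
by move=> /(nth_find 0%N); rewrite nth_iota.
Qed.

Lemma is_stopping_time_first_failure : is_stopping_time first_failure.
Proof.
split=> [x [s0]|n n0]; first by have := size_gt0 (first_bad x); rewrite s0.
(* Stopping by time [n] means that some [i < K] with [size i <= n] is bad, or that [size K <= n], in
   which case every path has stopped. *)
pose F i : set (seqspace R) := if (i <= K)%N && (size i <= n)%N
  then (if (i < K)%N then [set x | bad i x] else setT) else set0.
rewrite (_ : [set x | _] = \bigcup_i F i).
  apply: sigma_algebra_bigcup => i; rewrite /F.
  case: ifPn => [/andP[iK sn]|_]; last exact: sigma_algebra0.
  case: ifPn => _; last exact: natural_filtrationT.
  by apply: natural_filtration_nd sn _; exact: bad_adapted.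
apply/seteqP; split => [x /= [m [<-] fn]|x /= [i _]].
  exists (first_bad x) => //; rewrite /F first_bad_le fn /=.
  by case: ifPn => // fK; exact: first_badP.
rewrite /F; case: ifPn => // /andP[iK sn].
move=> Fx; exists (size (first_bad x)) => //; apply: leq_trans sn.
apply: size_nd; case: ltnP Fx => [ik|Ki _]; first exact: first_bad_min.
exact: leq_trans (first_bad_le x) Ki.
Qed.

End first_failure.

(** * Lower bound for an arbitrary estimator *)

Section lower_bound.
Context {R : realType}.
Variable P : R -> probability (seqspace R) R.
Hypothesis iidP : forall mu, iid_normal1 mu (P mu).
Variable muhat : forall n, n.-tuple R -> R.
Hypothesis mmuhat : is_estimator muhat.

Let estimate n (x : seqspace R) : R := muhat (obs n x).

Let measurable_estimate n : measurable_fun [set: seqspace R] (estimate n).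
Proof.
by apply: (@measurableT_comp _ _ _ _ _ _ (@muhat n) _ (@obs R n)) => //; [exact: mmuhat|exact: measurable_obs].
Qed.

(** Otherwise [tree_bound] would bound by 2 a harmonic sum divided by [ln 64], for every length of
    the window. The window starts at [m.+1] so that all its times exceed [m]. *)
Lemma exists_inaccurate m : exists mu K,
  (P mu (accurate (fun i : 'I_K => estimate (64 ^ (m.+1 + i)))
    (fun i => gap (m.+1 + i)) mu) < (3 / 4)%:E)%E.
Proof.
have l0 : 0 < ln 64 :> R by have := @ln64_ge3 R; lra.
have [K harm] := harmonic_tail_unbounded m (2 * ln (64 : R)).
apply: contrapT => /forallNP always.
suff : \sum_(i < K) (m.+1 + i)%:R^-1 / ln 64 <= 2 :> R.
  by rewrite -mulr_suml ler_pdivrMr//; lra.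
have -> : \sum_(i < K) (m.+1 + i)%:R^-1 / ln 64 = \sum_(i < K)
    expR (- ((64 ^ (m.+1 + i))%N%:R * gap (m.+1 + i) ^+ 2 / 4)) :> R.
  by apply: eq_bigr => i _; rewrite addSn affinity_gap.
apply: (tree_bound iidP (n := fun i => (64 ^ (m.+1 + i))%N)
  (T := fun i : 'I_K => estimate (64 ^ (m.+1 + i)))).
- by move=> i j ij; rewrite leq_exp2l// leq_add2l.
- by move=> i; exact: measurable_estimate.
- by move=> i x y xy; rewrite /estimate (depends_on_obs xy).
- by move=> i; exact: gap_gt0.
- by move=> j; exact: gap_tail.
- move=> nu; rewrite leNgt; apply/negP => lt34; apply: (always nu).
  by exists K.
Qed.

(** At a bad time the squared error is at least [(gap / 4) ^+ 2], which is a quarter of the rate,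
    and inaccuracy has probability above 1/4: hence the 16. The pair [mu], [tau] is found before [r]
    and [A]. *)
Lemma exists_bad_stopping_time m : exists mu tau, finite_stopping_times P tau /\
  forall (r : nat -> R) (A : R), 0 <= A ->
    (forall n, (m <= n)%N -> (0 < n)%N -> 0 < r n /\ A * r n <= rate n) ->
    ((A / 16)%:E <= stopped_risk P muhat r mu tau)%E.
Proof.
have [mu [K inacc]] := exists_inaccurate m.
pose size i := (64 ^ (m.+1 + i))%N.
pose bad i (x : seqspace R) := gap (m.+1 + i) / 4 <= `|mu - estimate (size i) x|.
have size_gt0 i : (0 < size i)%N by rewrite expn_gt0.
have size_ge i : (m <= size i)%N.
  by rewrite ltnW// (leq_trans (leq_addr i m.+1))// ltnW// ltn_expl.
have size_nd i j : (i <= j)%N -> (size i <= size j)%N.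
  by move=> ij; rewrite leq_exp2l// leq_add2l.
have bad_adapted i : natural_filtration (size i) [set x | bad i x].
  apply: (@natural_filtration_obs _ (size i)
    [set t | gap (m.+1 + i) / 4 <= `|mu - muhat t|]).
  rewrite (_ : [set t | _] =
    setT `&` (fun t => `|mu - muhat t|) @^-1` `[gap (m.+1 + i) / 4, +oo[).
    have : measurable_fun setT (fun t : (size i).-tuple R => `|mu - muhat t|).
      apply: measurableT_comp => //; apply: measurable_funB => //.
      exact: mmuhat.
    by apply => //; exact: measurable_itv.
  by rewrite setTI; apply/seteqP; split => t /=; rewrite in_itv /= andbT.
exists mu, (first_failure size bad K); split.
  split; first exact: is_stopping_time_first_failure.
  by move=> nu; apply: aeW.
move=> r A A0 rA.
have r_gt0 x : 0 < r (size (first_bad bad K x)) by have [] := rA _ (size_ge (first_bad bad K x)) (size_gt0 (first_bad bad K x)).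
set acc := accurate _ _ mu in inacc.
have macc : measurable acc.
  by apply: measurable_accurate => i; exact: measurable_estimate.
apply: (@le_trans _ _ ((A / 4)%:E * P mu (~` acc))%E).
  rewrite probability_setC// (_ : (A / 16)%:E = (A / 4)%:E * (1 / 4)%:E)%E; last first.
    by rewrite -EFinM; congr EFin; field.
  rewrite lee_wpmul2l ?lee_fin ?divr_ge0//.
  move: inacc; rewrite -(@fineK _ (P mu acc)) ?fin_num_measure//.
  by rewrite -EFinB lte_fin lee_fin; lra.
apply: ge0_integral_ge_cst.
- exact: divr_ge0.
- exact: measurableC.
- by move=> x /=; rewrite lee_fin divr_ge0 ?sqr_ge0// ltW.
move=> x nacc /=; rewrite lee_fin /scaled_loss.
(* Off [acc] some index below [K] is bad, so [first_bad] is not the default [K]. *)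
have fK : (first_bad bad K x < K)%N.
  rewrite ltn_neqAle first_bad_le andbT; apply/eqP => fK; apply: nacc => i.
  rewrite ltNge; apply/negP => bi.
  by have := @first_bad_min _ bad K i x (ltn_ord i) bi; rewrite fK leqNgt ltn_ord.
have := first_badP fK; rewrite /bad /estimate; set n := size _ => bx.
have [rn An] := rA _ (size_ge (first_bad bad K x)) (size_gt0 _).
rewrite ler_pdivlMr//; rewrite -/n in rn An *.
apply: (@le_trans _ _ (rate n / 4)); first by rewrite mulrAC ler_wpM2r.
rewrite -real_normK ?num_real//.
have -> : rate n / 4 = (gap (m.+1 + first_bad bad K x) / 4) ^+ 2 :> R.
  by rewrite expr_div_n gap_sqr -/(size _) -/n; field.
by rewrite ler_sqr ?nnegrE// divr_ge0// ltW// gap_gt0.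
Qed.

Lemma worst_stopped_risk_ge (r : nat -> R) (A : R) m : 0 <= A ->
  (forall n, (m <= n)%N -> (0 < n)%N -> 0 < r n /\ A * r n <= rate n) ->
  ((A / 16)%:E <= worst_stopped_risk P muhat r)%E.
Proof.
move=> A0 rA; have [mu [tau [tauT risk]]] := exists_bad_stopping_time m.
apply: (le_trans (risk r A A0 rA)).
apply: (@le_trans _ _ (ereal_sup [set stopped_risk P muhat r mu tau
    | tau in finite_stopping_times P])).
  by apply: ereal_sup_ubound; exists tau.
by apply: ereal_sup_ubound; exists mu.
Qed.

End lower_bound.

Theorem theorem3p2 (R : realType) (P : R -> probability (seqspace R) R)
    (iidP : forall mu : R, iid_normal1 mu (P mu)) :
  (exists C : R, 0 < C /\
    (ereal_sup [set sup_risk P (@mle R) rate mu | mu in [set: R]] <= C%:E)%E)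
  /\
  (exists C : R, 0 < C /\
    forall muhat : (forall n : nat, n.-tuple R -> R), is_estimator muhat ->
      (C%:E <= worst_stopped_risk P muhat rate)%E /\
      (forall g : nat -> R,
        (forall n, (0 < n)%N -> 0 < g n) ->
        (forall m n, (0 < m)%N -> (m <= n)%N -> g n <= g m) ->
        (fun n => rate n / g n) @ \oo --> +oo ->
        worst_stopped_risk P muhat g = +oo%E)).
Proof.
split.
  have [C C0 risk_le] := @sup_risk_mle_le R.
  by exists C; split => //; apply: ge_ereal_sup => _ [mu _ <-]; exact: risk_le.
exists (1 / 16); split=> [|muhat mmuhat]; first by rewrite divr_gt0.
split=> [|g g0 _ /cvgryPge rate_g].
  apply: (worst_stopped_risk_ge iidP mmuhat (m := 0)) => // n _ _.
  by rewrite mul1r rate_gt0.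
(* To reach an arbitrary [A], take [m] beyond which the ratio is at least [A * 16]; the stopping
   times used take values from [m] on only. *)
apply/eqyP => A A0; have [m _ mg] := rate_g (A * 16).
rewrite -(mulfK (_ : 16 != 0) A)//.
apply: (worst_stopped_risk_ge iidP mmuhat (m := m)) => [|n mn n0].
  by rewrite mulr_ge0// ltW.
by rewrite g0// -ler_pdivlMr ?g0//; split=> //; exact: mg.
Qed.
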